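(* Let $n\geq 4$. Let $\lambda,\mu,\nu\vdash n$ and set $k=\max(\delta(\lambda),\delta(\mu),\delta(\nu))$. Then $$g(\lambda,\mu,\nu)\leq n^{8k^3}.$$
   Context: $\mathfrak{S}_n$ is the symmetric group on $n$ elements, and $\mathrm{ch}^\lambda$ is the character of the irreducible complex representation of $\mathfrak{S}_n$ indexed in the usual way by $\lambda\vdash n$ (with $[n]$ corresponding to the trivial representation). The Kronecker coefficient is $$g(\lambda,\mu,\nu)=\frac{1}{n!}\sum_{\sigma\in\mathfrak{S}_n}\mathrm{ch}^\lambda(\sigma)\,\mathrm{ch}^\mu(\sigma)\,\mathrm{ch}^\nu(\sigma).$$ $\delta(\lambda)=\max\{i\geq 1:\min(\lambda_i,\lambda_i')\geq i\}$ is the diagonal length of $\lambda$, where $\lambda_i$ and $\lambda_i'$ are the lengths of the $i$-th row and $i$-th column. *)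

(* Defs.v *)
From HB Require Import structures.
From mathcomp Require Import all_boot all_order all_algebra all_fingroup.
From mathcomp Require Import all_solvable all_field all_character.

Set Implicit Arguments.
Unset Strict Implicit.
Unset Printing Implicit Defensive.

Import Order.TTheory GRing.Theory Num.Theory GroupScope.
Local Open Scope ring_scope.

Definition is_partition (n : nat) (la : seq nat) : bool :=
  [&& sorted geq la, 0%N \notin la & sumn la == n].

(* Rows and columns are numbered from 1. *)
Definition row_len (la : seq nat) (i : nat) : nat := nth 0%N la i.-1.
Definition col_len (la : seq nat) (i : nat) : nat := count (leq i) la.

(* Since row i has length at most sumn la, the bound on i excludes nothing. *)
Definition diag_len (la : seq nat) : nat :=
  \max_(1 <= i < (sumn la).+1 | (i <= minn (row_len la i) (col_len la i))%N) i.

(* The Young tableau of shape la containing 0, ..., n-1 in reading order has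
   the entry m in row reshape_index la m and column reshape_offset la m (both
   numbered from 0). *)
Definition row_stab (n : nat) (la : seq nat) : {set 'S_n} :=
  [set s : 'S_n | [forall m : 'I_n,
     reshape_index la (s m) == reshape_index la m]].

Definition col_stab (n : nat) (la : seq nat) : {set 'S_n} :=
  [set s : 'S_n | [forall m : 'I_n,
     reshape_offset la (s m) == reshape_offset la m]].

(* Elements of the group algebra of 'S_n are encoded as row vectors, the basis
   vector of s being gring_row (regular_repr algC [set: 'S_n] s). *)
Definition young_symmetrizer (n : nat) (la : seq nat) :
    'rV[algC]_#|[set: 'S_n]| :=
  \sum_(p in row_stab n la) \sum_(q in col_stab n la)
    (-1) ^+ q *: gring_row (regular_repr algC [set: 'S_n] (p * q)%g).

(* MathComp representations act on row vectors from the right, so this is the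
   right ideal of the group algebra generated by the Young symmetrizer. *)
Definition specht_repr (n : nat) (la : seq nat) :=
  submod_repr (cyclic_mx_module (regular_repr algC [set: 'S_n])
                                (young_symmetrizer n la)).

Definition specht_char (n : nat) (la : seq nat) : 'CF([set: 'S_n]) :=
  cfRepr (specht_repr n la).

Definition kronecker (n : nat) (la mu nu : seq nat) : algC :=
  (n`!)%:R^-1 * \sum_(s : 'S_n)
    specht_char n la s * specht_char n mu s * specht_char n nu s.

(* Main.v *)
Require Import Defs.
From mathcomp Require Import all_boot all_order all_algebra all_fingroup.
From mathcomp Require Import all_solvable all_field all_character.
From mathcomp Require Import zify ring.

(* Write y = a b for the Young symmetrizer of la, where a = sum of the row stabilizer R
   and b = signed sum of the column stabilizer C. Let R1 be the part of R moving
   only the first k rows and C2 the part of C moving only the other rows, with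
   sums a1 and b2. As b = |C2|^-1 b2 b, y A lies in
   a b2 A (A the group algebra). Left multiplication by b2 is injective there,
   because b2 a b2 v = 0 forces a b2 v = 0 (a and b2 being multiples of
   orthogonal projections), and it lands in b2 a1 A. As a1 and b2 commute,
   b2 a1 is a multiple of an idempotent, so the Specht character is dominated
   by the character of b2 a1 A, the representation induced from R1 x C2 by
   1 x sign. When k is at least the diagonal length of la, every box below row k
   lies in the first k columns, so R1 x C2 is the stabilizer of a coloring of
   the n boxes by 2k colors (first k rows, first k columns); the values of the
   induced character are then bounded by the numbers of colorings fixed by the
   permutations. Multiplying three such bounds, Burnside's lemma bounds the
   Kronecker coefficient by the number of multisets of size n in a set of
   (2k)^3 elements. *)

Import Order.TTheory GRing.Theory Num.Theory.
Local Open Scope ring_scope.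

Set Implicit Arguments.
Unset Strict Implicit.
Unset Printing Implicit Defensive.

(** * Characters of submodules and matrix projections *)

(** An injective intertwiner [B] identifies [rG] with a submodule of [rH]; the difference is the
    character of the quotient. *)
Lemma cfRepr_sub_char (gT : finGroupType) (G : {group gT}) (m n : nat)
    (rG : mx_representation algC G m) (rH : mx_representation algC G n)
    (B : 'M_(m, n)) :
  row_free B -> (forall x, x \in G -> rG x *m B = B *m rH x) ->
  cfRepr rH - cfRepr rG \is a character.
Proof.
move=> freeB homB.
have modB: mxmodule rH <<B>>%MS.
  rewrite (eqmx_module _ (genmxE _)).
  by apply/mxmoduleP=> x Gx; rewrite -homB // submxMl.
have simB: mx_rsim rG (submod_repr modB).
  exists (in_submod <<B>>%MS B) => [||x Gx].
  - by rewrite genmxE (eqP freeB).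
  - by rewrite /row_free mxrank_in_submod ?genmxE.
  - by rewrite -in_submodJ ?genmxE // -homB // [RHS]in_submodE -mulmxA -in_submodE.
suff ->: cfRepr rH - cfRepr rG = cfRepr (factmod_repr modB) by apply: cfRepr_char.
rewrite (cfRepr_sim simB); apply/cfun_inP => x Gx; rewrite !cfunE Gx.
by rewrite !mulr1n -(mxtrace_sub_fact_mod modB x) addrAC subrr add0r.
Qed.

(** [c^-1 *: E] is idempotent with image [E], so the trace on the submodule is that of the action
    composed with this projection. *)
Lemma mxtrace_submod_proj (gT : finGroupType) (G : {group gT}) (n : nat)
    (rG : mx_representation algC G n) (E : 'M_n) (modE : mxmodule rG E)
    (c : algC) (x : gT) :
  c != 0 -> E *m E = c *: E -> x \in G ->
  \tr (submod_repr modE x) = c^-1 * \tr (E *m rG x).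
Proof.
move=> c0 E2 Gx.
(* [E = col_base E *m row_base E] is a full rank factorization, so the outer factors cancel from
   [E *m E = c *: E]. *)
have BD: row_base E *m col_base E = c%:M.
  apply: (row_full_inj (col_base_full E)); apply: (row_free_inj (row_base_free E)).
  rewrite /= mulmxA mulmx_base -mulmxA mulmx_base E2 mul_mx_scalar.
  by rewrite -scalemxAl mulmx_base.
have SB: submod_repr modE x *m row_base E = row_base E *m rG x.
  by have:= val_submodJ modE 1%:M Gx; rewrite /val_submod /= !mul1mx.
have ->: \tr (E *m rG x) = c * \tr (submod_repr modE x).
  rewrite -mxtraceZ -mul_mx_scalar -BD mulmxA SB [RHS]mxtrace_mulC.
  by rewrite (mulmxA (col_base E)) mulmx_base.
by rewrite mulrA mulVf // mul1r.
Qed.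

(** The diagonal entries of the product are the squared norms of the rows of [A]. *)
Lemma mul_conj_trmx_eq0 (m n : nat) (A : 'M[algC]_(m, n)) :
  A *m (map_mx Num.conj A)^T = 0 -> A = 0.
Proof.
move=> AA0; apply/matrixP=> i j; rewrite [RHS]mxE.
have /eqP := congr1 (fun B : 'M_m => B i i) AA0.
rewrite [X in X == _]mxE [X in _ == X]mxE psumr_eq0 => [/allP/(_ j)|l _].
  by rewrite mem_index_enum !mxE -normCK sqrf_eq0 normr_eq0 => /(_ isT)/eqP.
by rewrite !mxE -normCK exprn_ge0.
Qed.

(* A real symmetric A with A^2 = c A is a multiple of an orthogonal projection,
   so v B A B v^* is a multiple of the squared norm of v B A. *)
Lemma mulmx_proj_sym_eq0 (m n : nat) (v : 'M[algC]_(m, n)) (A B : 'M_n) (c : algC) :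
  A *m A = c *: A -> A^T = A -> map_mx Num.conj A = A ->
  B^T = B -> map_mx Num.conj B = B ->
  v *m B *m A *m B = 0 -> v *m B *m A = 0.
Proof.
move=> A2 At Ac Bt Bc vBAB; apply: mul_conj_trmx_eq0.
rewrite !map_mxM Ac Bc !trmx_mul At Bt !mulmxA -[_ *m A *m A]mulmxA A2.
by rewrite -!scalemxAr -!scalemxAl vBAB mul0mx scaler0.
Qed.

(** * Left multiplication on the group algebra and signed sums over subgroups *)

Section LeftRegular.

Variables (gT : finGroupType) (G : {group gT}).
Local Notation aG := (regular_repr algC G).

(* Left multiplication on the group algebra, as a matrix acting on row vectors
   from the right; hence an antihomomorphism. *)
Definition left_mx (x : gT) : 'M[algC]_#|G| :=
  \matrix_i delta_mx 0 (gring_index G (x * enum_val i)%g).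

Lemma delta_left_mx x y : x \in G -> y \in G ->
  delta_mx 0 (gring_index G y) *m left_mx x
    = delta_mx 0 (gring_index G (x * y)%g) :> 'rV_#|G|.
Proof. by move=> Gx Gy; rewrite -rowE rowK gring_indexK. Qed.

Lemma delta_regular_mx x y : x \in G -> y \in G ->
  delta_mx 0 (gring_index G y) *m aG x
    = delta_mx 0 (gring_index G (y * x)%g) :> 'rV_#|G|.
Proof. by move=> Gx Gy; rewrite -rowE rowK gring_indexK. Qed.

Lemma gring_matrixP (m : nat) (A B : 'M[algC]_(#|G|, m)) :
  (forall x, x \in G -> delta_mx 0 (gring_index G x) *m A
                       = delta_mx 0 (gring_index G x) *m B :> 'rV_m) ->
  A = B.
Proof.
move=> eqAB; apply/row_matrixP=> i.
by rewrite !rowE -[i]gring_valK eqAB ?enum_valP.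
Qed.

Lemma left_mxM x y : x \in G -> y \in G ->
  left_mx x *m left_mx y = left_mx (y * x).
Proof.
move=> Gx Gy; apply: gring_matrixP => z Gz.
by rewrite mulmxA !delta_left_mx ?groupM // mulgA.
Qed.

Lemma left_mx_regular x y : x \in G -> y \in G ->
  left_mx x *m aG y = aG y *m left_mx x.
Proof.
move=> Gx Gy; apply: gring_matrixP => z Gz; rewrite !mulmxA.
by rewrite delta_left_mx // !delta_regular_mx ?groupM // delta_left_mx ?groupM // mulgA.
Qed.

Lemma left_mxE x i j : x \in G ->
  left_mx x i j = (enum_val j == x * enum_val i)%g%:R.
Proof.
move=> Gx; rewrite !mxE eqxx /=; congr (_%:R); congr nat_of_bool.
have Gxi: (x * enum_val i)%g \in G by rewrite groupM ?enum_valP.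
by rewrite -[in RHS](gring_indexK _ Gxi) (inj_eq enum_val_inj).
Qed.

Lemma left_mx_tr x : x \in G -> (left_mx x)^T = left_mx x^-1.
Proof.
move=> Gx; apply/matrixP=> i j; rewrite mxE !left_mxE ?groupV //.
by rewrite -[in RHS](inj_eq (mulgI x)) mulKVg eq_sym.
Qed.

Lemma map_left_mx x : map_mx Num.conj (left_mx x) = left_mx x.
Proof. by apply/matrixP=> i j; rewrite !mxE rmorph_nat. Qed.

(** The product permutes the basis by sending [u] to [x * u * y], so its trace counts fixed
    points. *)
Lemma mxtrace_left_regular x y : x \in G -> y \in G ->
  \tr (left_mx x *m aG y) = \sum_(u in G) (x * u * y == u)%g%:R.
Proof.
move=> Gx Gy; rewrite big_enum_val; apply: eq_bigr => i _.
have Gi := enum_valP i.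
have ->: (left_mx x *m aG y) i i = ((delta_mx 0 i : 'rV_#|G|) *m left_mx x *m aG y) 0 i.
  by rewrite -mulmxA -rowE [RHS]mxE.
rewrite -{1}[i]gring_valK delta_left_mx // delta_regular_mx ?groupM //.
by rewrite mxE eqxx /= eq_sym -(inj_eq enum_val_inj) gring_indexK ?groupM.
Qed.

Variable sgn : gT -> bool.
Hypothesis sgnM : forall x y, sgn (x * y)%g = sgn x (+) sgn y.

(** A constantly false [sgn] gives the plain sum used for row groups; the parity of permutations
    gives the alternating sum for column groups. *)
Definition signed_sum (A : {set gT}) : 'M[algC]_#|G| :=
  \sum_(x in A) (-1) ^+ sgn x *: left_mx x.

Let sgn1 : sgn 1 = false.
Proof. by have := sgnM 1 1; rewrite mulg1; case: (sgn 1). Qed.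

Let sgnV x : sgn x^-1 = sgn x.
Proof. by have := sgnM x x^-1; rewrite mulgV sgn1; do 2 case: (sgn _). Qed.

Lemma left_mx_signed_sum (H : {group gT}) x : H \subset G -> x \in H ->
  left_mx x *m signed_sum H = (-1) ^+ sgn x *: signed_sum H.
Proof.
move=> sHG Hx; rewrite mulmx_sumr scaler_sumr.
rewrite [RHS](reindex_acts 'R _ Hx) ?astabsR //=.
apply: eq_bigr => y Hy; rewrite -scalemxAr left_mxM ?(subsetP sHG) //.
by rewrite scalerA -signr_addb sgnM addbC -addbA addbb addbF.
Qed.

Lemma signed_sum_left_mx (H : {group gT}) x : H \subset G -> x \in H ->
  signed_sum H *m left_mx x = (-1) ^+ sgn x *: signed_sum H.
Proof.
move=> sHG Hx; rewrite mulmx_suml scaler_sumr.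
rewrite [RHS](reindex_inj (mulgI x)) /=.
under [RHS]eq_bigl => y do rewrite groupMl //.
apply: eq_bigr => y Hy; rewrite -scalemxAl left_mxM ?(subsetP sHG) //.
by rewrite scalerA -signr_addb sgnM addbA addbb addFb.
Qed.

(** Each [x] in [K] is absorbed by the sum over [H] at the cost of the sign of [x], which its own
    coefficient cancels. *)
Lemma signed_sumM_subl (K H : {group gT}) : K \subset H -> H \subset G ->
  signed_sum K *m signed_sum H = #|K|%:R *: signed_sum H.
Proof.
move=> sKH sHG; rewrite {1}/signed_sum mulmx_suml.
rewrite (eq_bigr (fun _ => signed_sum H)) ?sumr_const ?scaler_nat //.
move=> x Kx; rewrite -scalemxAl left_mx_signed_sum ?(subsetP sKH) //.
by rewrite scalerA -signr_addb addbb scale1r.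
Qed.

Lemma signed_sumM_subr (K H : {group gT}) : K \subset H -> H \subset G ->
  signed_sum H *m signed_sum K = #|K|%:R *: signed_sum H.
Proof.
move=> sKH sHG; rewrite {2}/signed_sum mulmx_sumr.
rewrite (eq_bigr (fun _ => signed_sum H)) ?sumr_const ?scaler_nat //.
move=> x Kx; rewrite -scalemxAr signed_sum_left_mx ?(subsetP sKH) //.
by rewrite scalerA -signr_addb addbb scale1r.
Qed.

Lemma signed_sum_tr (H : {group gT}) : H \subset G ->
  (signed_sum H)^T = signed_sum H.
Proof.
move=> sHG; rewrite /signed_sum raddf_sum [RHS](reindex_inj invg_inj) /=.
under [RHS]eq_bigl => y do rewrite groupV.
by apply: eq_bigr => y Hy; rewrite /= linearZ /= left_mx_tr ?(subsetP sHG) // sgnV.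
Qed.

Lemma map_signed_sum (A : {set gT}) :
  map_mx Num.conj (signed_sum A) = signed_sum A.
Proof.
rewrite /signed_sum raddf_sum; apply: eq_bigr => x _ /=.
by rewrite map_mxZ map_left_mx rmorph_sign.
Qed.

Lemma signed_sum_regular (A : {set gT}) x : A \subset G -> x \in G ->
  signed_sum A *m aG x = aG x *m signed_sum A.
Proof.
move=> sAG Gx; rewrite mulmx_sumr mulmx_suml; apply: eq_bigr => y Ay.
by rewrite -scalemxAl -scalemxAr left_mx_regular ?(subsetP sAG y).
Qed.

End LeftRegular.

(** * Embedding the Young module into an induced module *)

Section YoungEmbedding.

Variables (gT : finGroupType) (G R C R1 C2 : {group gT}) (sgn : gT -> bool).
Hypotheses (sgnM : forall x y, sgn (x * y)%g = sgn x (+) sgn y).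
Hypotheses (sRG : R \subset G) (sCG : C \subset G).
Hypotheses (sR1R : R1 \subset R) (sC2C : C2 \subset C) (cRC : C2 \subset 'C(R1)%g).
Local Notation aG := (regular_repr algC G).

Let y : 'rV[algC]_#|G| := \sum_(p in R) \sum_(q in C)
  (-1) ^+ sgn q *: gring_row (aG (p * q)%g).
Let La := signed_sum G (fun => false) R.
Let Lb := signed_sum G sgn C.
Let La1 := signed_sum G (fun => false) R1.
Let Lb2 := signed_sum G sgn C2.
Let E := La1 *m Lb2.

Let sR1G : R1 \subset G. Proof. exact: subset_trans sR1R sRG. Qed.
Let sC2G : C2 \subset G. Proof. exact: subset_trans sC2C sCG. Qed.

Let La1Lb2 : La1 *m Lb2 = Lb2 *m La1.
Proof.
rewrite mulmx_suml mulmx_sumr; apply: eq_bigr => p R1p.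
rewrite mulmx_suml mulmx_sumr; apply: eq_bigr => q C2q.
have Gp := subsetP sR1G p R1p; have Gq := subsetP sC2G q C2q.
rewrite -!scalemxAr -!scalemxAl !left_mxM // scalerA mulrC -scalerA.
by rewrite (centP (subsetP cRC q C2q) p R1p).
Qed.

Let cardG_neq0 (H : {group gT}) : #|H|%:R != 0 :> algC.
Proof. by rewrite pnatr_eq0 -lt0n cardG_gt0. Qed.

Let E2 : E *m E = (#|R1| * #|C2|)%:R *: E.
Proof.
rewrite {1}/E La1Lb2 mulmxA -(mulmxA _ La1 La1) signed_sumM_subl //.
rewrite -scalemxAr -scalemxAl -La1Lb2 -mulmxA signed_sumM_subl //.
by rewrite -scalemxAr scalerA -natrM.
Qed.

Let modE : mxmodule aG E.
Proof.
apply/mxmoduleP => x Gx; rewrite /E -mulmxA signed_sum_regular // mulmxA.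
by rewrite signed_sum_regular // -mulmxA submxMl.
Qed.

Let gring_rowE x : x \in G -> gring_row (aG x) = delta_mx 0 (gring_index G x).
Proof. by move=> Gx; rewrite /gring_row rowE delta_regular_mx ?mul1g. Qed.

(** Matrices of left multiplications compose in reverse order, hence [Lb] precedes [La] although [y]
    is [a b]. *)
Let yE : y = delta_mx 0 (gring_index G 1%g) *m Lb *m La.
Proof.
rewrite /La /signed_sum mulmx_sumr; apply: eq_bigr => p Rp.
rewrite expr0 scale1r mulmx_sumr mulmx_suml; apply: eq_bigr => q Cq.
have Gp := subsetP sRG p Rp; have Gq := subsetP sCG q Cq.
rewrite -scalemxAr -scalemxAl delta_left_mx // mulg1 delta_left_mx //.
by rewrite gring_rowE ?groupM.
Qed.

Let sub_cyclic : (cyclic_mx aG y <= Lb2 *m La)%MS.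
Proof.
have LbE : Lb = #|C2|%:R^-1 *: (Lb *m Lb2).
  by rewrite signed_sumM_subr // scalerA mulVf // scale1r.
have sLbLa : (Lb *m La <= Lb2 *m La)%MS.
  by rewrite LbE -scalemxAl scalemx_sub // -mulmxA submxMl.
apply: submx_trans sLbLa; apply: cyclic_mx_sub; last first.
  by rewrite yE -mulmxA submxMl.
apply/mxmoduleP => x Gx; rewrite -mulmxA signed_sum_regular // mulmxA.
by rewrite signed_sum_regular // -mulmxA submxMl.
Qed.

Let sub_image : (Lb2 *m La *m Lb2 <= E)%MS.
Proof.
have ->: La = #|R1|%:R^-1 *: (La *m La1).
  by rewrite signed_sumM_subr // scalerA mulVf // scale1r.
by rewrite -scalemxAr -scalemxAl scalemx_sub // mulmxA -(mulmxA _ La1) submxMl.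
Qed.

(** Left multiplication by [b2] is injective on the image of [a b2]: the projection argument applies
    with [La] and [Lb2]. *)
Let ker0 (m : nat) (v : 'M_(m, #|G|)) :
  (v <= Lb2 *m La)%MS -> v *m Lb2 = 0 -> v = 0.
Proof.
case/submxP=> w ->; rewrite mulmxA.
apply: (@mulmx_proj_sym_eq0 _ _ _ _ _ #|R|%:R); rewrite ?map_signed_sum //.
- exact: signed_sumM_subl.
- exact: signed_sum_tr.
- exact: signed_sum_tr.
Qed.

Lemma young_module_char :
  exists psi : 'CF(G),
    [/\ psi \is a character,
        psi - cfRepr (submod_repr (cyclic_mx_module aG y)) \is a character
      & forall g, g \in G -> `|psi g| <= (#|R1| * #|C2|)%:R^-1 *
          \sum_(p in R1) \sum_(q in C2) \sum_(u in G) (q * p * u * g == u)%g%:R].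
Proof.
exists (cfRepr (submod_repr modE)); split.
- exact: cfRepr_char.
- set modU := cyclic_mx_module _ _; set U := cyclic_mx _ _ in modU *.
  have sUE : (row_base U *m Lb2 <= E)%MS.
    apply: submx_trans sub_image; apply: submxMr.
    by rewrite eq_row_base.
  (* The injective intertwiner is left multiplication by [b2], written in the basis [row_base U]. *)
  apply: (cfRepr_sub_char (B := in_submod E (row_base U *m Lb2))) => [|x Gx].
    rewrite /row_free mxrank_in_submod //; apply: inj_row_free => v.
    rewrite mulmxA => /ker0 vU0; apply: (row_free_inj (row_base_free U)).
    rewrite mul0mx vU0 //; apply: mulmx_sub.
    by rewrite eq_row_base.
  have SB : submod_repr modU x *m row_base U = row_base U *m aG x.
    by have:= val_submodJ modU 1%:M Gx; rewrite /val_submod /= !mul1mx.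
  have eqJ : row_base U *m Lb2 *m aG x
      = submod_repr modU x *m (row_base U *m Lb2).
    by rewrite -mulmxA signed_sum_regular // mulmxA -SB -mulmxA.
  by rewrite -in_submodJ // eqJ in_submodE (mulmxA (submod_repr modU x)) -in_submodE.
move=> g Gg; rewrite cfunE Gg mulr1n.
have c0 : (#|R1| * #|C2|)%:R != 0 :> algC by rewrite natrM mulf_neq0.
rewrite (mxtrace_submod_proj modE c0 E2 Gg) normrM.
rewrite ger0_norm ?invr_ge0 ?ler0n // ler_wpM2l ?invr_ge0 ?ler0n //.
(* Each term has as trace a sign times a number of fixed points, so the triangle inequality removes
   the signs. *)
rewrite /E /La1 /signed_sum !mulmx_suml raddf_sum (le_trans (ler_norm_sum _ _ _)) //.
apply: ler_sum => p R1p; rewrite expr0 scale1r mulmx_sumr mulmx_suml raddf_sum.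
rewrite (le_trans (ler_norm_sum _ _ _)) //; apply: ler_sum => q C2q /=.
have Gp := subsetP sR1G p R1p; have Gq := subsetP sC2G q C2q.
rewrite -scalemxAr -scalemxAl mxtraceZ normrM normr_sign mul1r left_mxM //.
by rewrite mxtrace_left_regular ?groupM // ger0_norm // sumr_ge0.
Qed.

End YoungEmbedding.

(** * Colorings, their stabilizers and their orbits *)

(** [row_stab] and [col_stab] are instances by conversion, for the colorings by row and by column
    index; one proof makes both of them groups. *)
Definition color_stab (n : nat) (X : eqType) (f : 'I_n -> X) : {set 'S_n} :=
  [set h : 'S_n | [forall m, f (h m) == f m]].

Lemma color_stab_group_set (n : nat) (X : eqType) (f : 'I_n -> X) :
  group_set (color_stab f).
Proof.
apply/group_setP; split=> [|p q].
  by rewrite inE; apply/forallP => m; rewrite perm1.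
rewrite !inE => /forallP pf /forallP qf; apply/forallP => m.
by rewrite permM (eqP (qf _)).
Qed.

Canonical row_stab_group (n : nat) (la : seq nat) :=
  @Group _ (row_stab n la) (color_stab_group_set (fun m : 'I_n => reshape_index la m)).
Canonical col_stab_group (n : nat) (la : seq nat) :=
  @Group _ (col_stab n la) (color_stab_group_set (fun m : 'I_n => reshape_offset la m)).

Section Colorings.

Variables (n : nat) (X : finType).

Definition coloring_fix (g : 'S_n) : {set {ffun 'I_n -> X}} :=
  [set F : {ffun 'I_n -> X} | [forall m, F (g m) == F m]].

(** The condition says that [u * g * u^-1] is the inverse of [q * p], which stabilizes [f]; hence
    [g] fixes the coloring [F u]. For each [u] at most one pair [p], [q] occurs, as [R1] and [C2]
    meet trivially. *)
Lemma sum_young_le_fix (f : 'I_n -> X) (R1 C2 : {group 'S_n}) (g : 'S_n) :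
  (R1 :&: C2 = 1)%g -> C2 \subset 'C(R1)%g -> (R1 * C2)%g = color_stab f ->
  (\sum_(p in R1) \sum_(q in C2) \sum_(u : 'S_n) (q * p * u * g == u)%g
    <= #|coloring_fix g| * (#|R1| * #|C2|))%N.
Proof.
move=> tiRC cRC stabE.
pose F (u : 'S_n) := [ffun m => f (u^-1 m)%g].
have memR1C2 (x : 'S_n * 'S_n) : x \in setX R1 C2 -> (x.2 * x.1)%g \in color_stab f.
  rewrite inE => /andP[Rp Cq]; rewrite -stabE (centP (subsetP cRC _ Cq) _ Rp).
  exact: mem_mulg.
have le_fix : (\sum_(p in R1) \sum_(q in C2) \sum_(u : 'S_n) (q * p * u * g == u)%g
    <= \sum_(u : 'S_n) (F u \in coloring_fix g))%N.
  rewrite pair_big_dep exchange_big /=; apply: leq_sum => u _.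
  pose D := [set x in setX R1 C2 | x.2 * x.1 * u * g == u]%g.
  have -> : (\sum_(x | (x.1 \in R1) && (x.2 \in C2)) (x.2 * x.1 * u * g == u)%g)%N = #|D|.
    by rewrite -sum1_card big_mkcond [RHS]big_mkcond; apply: eq_bigr => x _;
      rewrite !inE; case: andP; case: eqP.
  have [Fix|nFix] := boolP (F u \in _).
    apply/card_le1_eqP => -[p q] [p' q'].
    rewrite !inE /= => /andP[/andP[Rp Cq] /eqP E1] /andP[/andP[Rp' Cq'] /eqP E2].
    have qpE : (q * p = q' * p')%g.
      by apply: (mulIg (u * g)%g); rewrite !mulgA E1 E2.
    have : (q'^-1 * q)%g \in (R1 :&: C2)%g.
      rewrite inE (groupM (groupVr Cq')) // andbT.
      have -> : (q'^-1 * q = p' * p^-1)%g.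
        by apply: (mulgI q'); apply: (mulIg p); rewrite mulKVg mulgA mulgKV.
      by rewrite groupM ?groupV.
    rewrite tiRC => /set1P qq.
    have qE : q = q' by apply/esym/eqP; rewrite eq_mulVg1 qq.
    by move: qpE; rewrite qE => /mulgI->.
  rewrite leqn0 cards_eq0; apply: contraNT nFix => /set0Pn[[p q]].
  rewrite inE => /andP[/memR1C2/= qpf /eqP qpug].
  rewrite inE; apply/forallP => m; rewrite !ffunE; apply/eqP.
  move: qpf; rewrite inE => /forallP/(_ (u^-1 (g m))%g)/eqP <-.
  have /permP/(_ (u^-1 (g m))%g) := qpug; rewrite !permM permKV => /perm_inj Em.
  by congr (f _); rewrite -[LHS](permK u) Em.
apply: leq_trans le_fix _.
have -> : (\sum_u (F u \in coloring_fix g) = \sum_(u | F u \in coloring_fix g) 1)%N.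
  by rewrite [RHS]big_mkcond; apply: eq_bigr => u _; case: ifP.
(* The permutations [u] are grouped by [F u]; a nonempty fiber lies in one coset of [color_stab f],
   of size [#|R1| * #|C2|]. *)
rewrite (partition_big F (mem (coloring_fix g))) //= -sum_nat_const.
apply: leq_sum => H _; rewrite sum1_card.
have [->|/card_gt0P[u0]] := posnP #|[pred u | (F u \in coloring_fix g) && (F u == H)]|.
  by [].
rewrite inE => /andP[_ /eqP Fu0].
rewrite -TI_cardMg // stabE.
apply: leq_trans (leq_imset_card (fun h => h^-1 * u0)%g (mem (color_stab f))).
apply/subset_leq_card/subsetP => u; rewrite unfold_in /= => /andP[_ /eqP Fu].
apply/imsetP; exists (u0 * u^-1)%g; last by rewrite invMg invgK mulgKV.
rewrite inE; apply/forallP => m; rewrite permM.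
have /ffunP/(_ (u0 m)) : F u = F u0 by rewrite Fu.
by rewrite !ffunE permK => ->.
Qed.

(** The inverse makes this a right action, permutations being composed from left to right. *)
Definition recolor (F : {ffun 'I_n -> X}) (g : 'S_n) : {ffun 'I_n -> X} :=
  [ffun m => F (g^-1 m)%g].

Lemma recolor_is_action : is_action [set: 'S_n] recolor.
Proof.
apply: is_total_action => [F|F g h]; apply/ffunP => m; rewrite !ffunE.
  by rewrite invg1 perm1.
by rewrite invMg permM.
Qed.

Canonical recolor_action := Action recolor_is_action.

Lemma afix_recolor (g : 'S_n) : 'Fix_recolor_action[g]%g = coloring_fix g.
Proof.
apply/setP => F; rewrite [RHS]inE; apply/afix1P/forallP => [/ffunP Fg m|Fg].
  by rewrite -(Fg (g m)) /= ffunE permK.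
by apply/ffunP => m; rewrite /= ffunE -(eqP (Fg _)) permKV.
Qed.

(** Sorting the colors moves any coloring to a nondecreasing one in the same orbit, and there are
    ['C(n + N, n)] of these. *)
Lemma recolor_orbits_le (N : nat) : #|X| = N.+1 ->
  (#|orbit recolor_action [set: 'S_n] @: [set: {ffun 'I_n -> X}]| <= 'C(n + N, n))%N.
Proof.
move=> cardX; rewrite -card_sorted_tuples.
pose col (t : n.-tuple 'I_N.+1) : {ffun 'I_n -> X} :=
  [ffun m => enum_val (cast_ord (esym cardX) (tnth t m))].
apply: leq_trans (leq_imset_card (fun t => orbit recolor_action [set: 'S_n] (col t)) _).
apply/subset_leq_card/subsetP => _ /imsetP[F _ ->]; apply/imsetP.
pose t : n.-tuple 'I_N.+1 := [tuple cast_ord cardX (enum_rank (F m)) | m < n].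
pose r := relpre (@nat_of_ord N.+1) leq.
exists (sort_tuple r t).
  rewrite inE /= sorted_map; apply: sort_sorted => x y; exact: leq_total.
have /tuple_permP[q sE] : perm_eq (sort r t) t by rewrite perm_sort.
apply/orbit_eqP/orbitP; exists q; first by rewrite inE.
have tnthE i : tnth (sort_tuple r t) i = tnth t (q i).
  by rewrite -[RHS](tnth_mktuple (fun i => tnth t (q i))); congr tnth; apply: val_inj.
apply/ffunP => m; rewrite !ffunE tnthE permKV tnth_mktuple.
by rewrite cast_ordK enum_rankK.
Qed.

Lemma sum_coloring_fix_le (N : nat) : #|X| = N.+1 ->
  (\sum_(g : 'S_n) #|coloring_fix g| <= 'C(n + N, n) * n`!)%N.
Proof.
move=> cardX; have acts : [acts [set: 'S_n], on [set: {ffun 'I_n -> X}] | recolor_action]%g.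
  by apply/actsP => g _ F; rewrite !inE.
have := Frobenius_Cauchy acts; rewrite cardsT card_Sn => sumE.
apply: leq_trans (leq_mul (recolor_orbits_le cardX) (leqnn _)); rewrite -sumE.
rewrite [leqRHS]big_mkcond /=; apply: leq_sum => g _.
by rewrite inE setTI afix_recolor.
Qed.

End Colorings.

(** * A binomial bound and triples of colorings *)

(** From [N.+1] to [N.+2] the binomial grows by the factor [(n + N + 2) / (N + 2)], at most [n].
    From 0 to 1 the factor is [n + 1], so the case 1 is checked directly as [n + 1 <= n ^ 2]. *)
Lemma bin_le_expn (n N : nat) : (2 <= n)%N -> ('C(n + N, n) <= n ^ N.+1)%N.
Proof.
move=> n2; elim: N => [|[_|N IHN]]; first by rewrite addn0 binn expn1 ltnW.
  by rewrite addn1 binSn; nia.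
have n0 : (0 < n)%N by apply: ltnW.
rewrite -(leq_pmul2l (ltn0Sn N.+1)).
have := mul_bin_down (n + N.+2) n; rewrite addKn addnS /= => <-.
apply: (@leq_trans ((N.+2 * n) * 'C(n + N.+1, n))); last first.
  by rewrite -mulnA leq_pmul2l // expnS leq_pmul2l.
by rewrite leq_mul2r; apply/orP; right; nia.
Qed.

(** Three colorings fixed by [g] combine into one by triples of colors; a product of three character
    bounds thus reduces to a single orbit count. *)
Lemma card_coloring_fix3 (n : nat) (X : finType) (g : 'S_n) :
  (#|coloring_fix X g| ^ 3 <= #|coloring_fix (X * X * X)%type g|)%N.
Proof.
pose A := coloring_fix X g.
pose mix (x : {ffun 'I_n -> X} * {ffun 'I_n -> X} * {ffun 'I_n -> X})
  : {ffun 'I_n -> X * X * X} := [ffun m => (x.1.1 m, x.1.2 m, x.2 m)].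
have mix_inj : injective mix.
  move=> [[a b] c] [[a' b'] c'] /ffunP E.
  by congr (_, _, _); apply/ffunP => m; move: (E m); rewrite !ffunE => -[].
have -> : (#|A| ^ 3 = #|mix @: setX (setX A A) A|)%N.
  by rewrite card_imset // !cardsX expnSr expnS expn1.
apply/subset_leq_card/subsetP => _ /imsetP[[[a b] c] abc ->].
move: abc; rewrite !inE /= => /andP[/andP[/forallP fa /forallP fb] /forallP fc].
by apply/forallP => m; rewrite !ffunE /= (eqP (fa m)) (eqP (fb m)) (eqP (fc m)).
Qed.

Lemma astab_permP (T : finType) (S : {set T}) (s : {perm T}) :
  reflect (forall x, x \in S -> s x = x) (s \in 'C(S | 'P)%g).
Proof. by apply: (iffP astabP). Qed.

(** * Diagonal length and the shape of the tableau *)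

(** Rows are numbered from 0 here: if row [k] were longer than [k], rows 0 to [k] would contain a
    square of side [k.+1]. *)
Lemma nth_diag_len_le (la : seq nat) (k : nat) :
  sorted geq la -> (diag_len la <= k)%N -> (nth 0%N la k <= k)%N.
Proof.
move=> sla; apply: contraTT; rewrite -!ltnNge => ltk.
have kla : (k < size la)%N by case: ltnP => // le; move: ltk; rewrite nth_default.
have anti i : (i <= k)%N -> (k < nth 0%N la i)%N.
  move=> ik; apply: leq_trans ltk _.
  have geqT : transitive geq by move=> a b c /= ab bc; apply: leq_trans bc ab.
  have := sorted_leq_nth geqT leqnn 0%N sla; apply=> //.
  by rewrite inE (leq_ltn_trans ik).
have countk : (k < count (leq k.+1) la)%N.
  rewrite -[la](cat_take_drop k.+1) count_cat.
  have : all (leq k.+1) (take k.+1 la).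
    apply/(all_nthP 0%N) => i; rewrite size_takel // => ik.
    by rewrite nth_take // anti.
  by rewrite all_count => /eqP ->; rewrite size_takel // leq_addr.
(* The candidate [k.+1] is in the range of the maximum because row [k] alone has more than [k]
   boxes. *)
rewrite /diag_len; apply: (bigmaxn_sup_seq k.+1) => //.
  rewrite mem_index_iota /= ltnS; apply: leq_trans ltk _.
  rewrite -[in sumn la](cat_take_drop k la) (drop_nth 0%N kla) sumn_cat /=.
  by rewrite addnCA leq_addr.
by rewrite leq_min /row_len ltk.
Qed.

(** The offset of a box is below the length of its row, which is at most that of row [k], hence at
    most [k]. *)
Lemma reshape_offset_lt (n : nat) (la : seq nat) (k : nat) (m : 'I_n) :
  is_partition n la -> (diag_len la <= k)%N -> (k <= reshape_index la m)%N ->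
  (reshape_offset la m < k)%N.
Proof.
case/and3P=> sla _ /eqP sumla dk km.
have mla : (m < sumn la)%N by rewrite sumla.
apply: leq_trans (reshape_offsetP mla) _.
apply: leq_trans (nth_diag_len_le sla dk).
have geqT : transitive geq by move=> a b c /= ab bc; apply: leq_trans bc ab.
have := sorted_leq_nth geqT leqnn 0%N sla; apply=> //.
  by rewrite inE (leq_ltn_trans km) // reshape_indexP.
by rewrite inE reshape_indexP.
Qed.

(** * Bounding a Specht character by fixed colorings *)

Lemma specht_char_coloring (n : nat) (la : seq nat) (k : nat) :
  is_partition n la -> (diag_len la <= k)%N ->
  exists psi : 'CF([set: 'S_n]),
    [/\ psi \is a character, psi - specht_char n la \is a character
      & forall g, `|psi g| <= #|coloring_fix 'I_(k + k) g|%:R].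
Proof.
move=> lan dk.
pose row (m : 'I_n) := reshape_index la m.
pose col (m : 'I_n) := reshape_offset la m.
(* Boxes of the first [k] rows are colored by row, the others by column shifted by [k]; the diagonal
   bound keeps these columns below [k]. *)
pose color (m : 'I_n) := if (row m < k)%N then row m else (k + col m)%N.
have color_lt m : (color m < k + k)%N.
  rewrite /color; case: (ltnP (row m) k) => [mk|km]; first exact: ltn_addr.
  by rewrite ltn_add2l reshape_offset_lt.
pose f m : 'I_(k + k) := Ordinal (color_lt m).
pose T := [set m : 'I_n | (row m < k)%N].
pose R1 := [group of 'C_(row_stab n la)(~: T | 'P)]%g.
pose C2 := [group of 'C_(col_stab n la)(T | 'P)]%g.
have R1P (p : 'S_n) : reflect ((forall m, row (p m) = row m) /\ {in ~: T, forall m, p m = m})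
    (p \in R1).
  rewrite /= inE; apply: (iffP andP) => -[].
    rewrite inE => /forallP pr /astab_permP pT; split=> // m.
    exact/eqP/pr.
  move=> pr pT; split; first by rewrite inE; apply/forallP => m; apply/eqP/pr.
  exact/astab_permP.
have C2P (p : 'S_n) : reflect ((forall m, col (p m) = col m) /\ {in T, forall m, p m = m})
    (p \in C2).
  rewrite /= inE; apply: (iffP andP) => -[].
    rewrite inE => /forallP pr /astab_permP pT; split=> // m.
    exact/eqP/pr.
  move=> pr pT; split; first by rewrite inE; apply/forallP => m; apply/eqP/pr.
  exact/astab_permP.
have R1T (p : 'S_n) m : p \in R1 -> (p m \in T) = (m \in T).
  by case/R1P=> pr _; rewrite !inE pr.
have C2T (q : 'S_n) m : q \in C2 -> (q m \in T) = (m \in T).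
  case/C2P=> _ qT; apply/idP/idP => [qmT|mT]; last by rewrite qT.
  by have /perm_inj <- := qT _ qmT.
have tiRC : (R1 :&: C2 = 1)%g.
  apply/trivgP/subsetP => p /setIP[/R1P[_ pT'] /C2P[_ pT]].
  rewrite inE; apply/eqP/permP => m; rewrite perm1.
  by have [mT|mT] := boolP (m \in T); [apply: pT | apply: pT'; rewrite inE].
have cRC : C2 \subset 'C(R1)%g.
  apply/subsetP => q Cq; apply/centP => p Rp; apply/permP => m; rewrite !permM.
  have [[_ qT] [_ pT]] := (C2P q Cq, R1P p Rp).
  have [mT|mT] := boolP (m \in T).
    by rewrite !qT ?R1T.
  by rewrite !pT ?in_setC ?C2T.
(* A permutation preserving colors preserves [T]; its restrictions to [T] and to the complement are
   the factors in [R1] and [C2]. *)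
have stabE : (R1 * C2)%g = color_stab f.
  apply/setP => h; apply/mulsgP/idP => [[p q Rp Cq ->]|].
    rewrite inE; apply/forallP => m; apply/eqP/val_inj; rewrite /= /color permM.
    have [[qc qT] [pr pT]] := (C2P q Cq, R1P p Rp).
    have [mT|mT] := boolP (m \in T); first by rewrite qT ?R1T // !pr; move: mT; rewrite inE => ->.
    have qmT : q m \notin T by rewrite C2T.
    rewrite pT ?in_setC //; move: mT qmT; rewrite !inE => /negPf-> /negPf->.
    by rewrite qc.
  rewrite inE => /forallP hf.
  have colorh m : color (h m) = color m by have /eqP/(congr1 val) := hf m.
  have hT m : (h m \in T) = (m \in T).
    move: (colorh m); rewrite !inE /color.
    case: (ltnP (row (h m)) k) => hk; case: (ltnP (row m) k) => mk // E.
      by move: hk; rewrite E ltnNge leq_addr.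
    by move: mk; rewrite -E ltnNge leq_addr.
  have hN : h \in 'N(T | 'P)%g by apply/astabsP => m; rewrite hT.
  have hN' : h \in 'N(~: T | 'P)%g by rewrite astabsC.
  exists (restr_perm T h) (restr_perm (~: T) h).
  - apply/R1P; split=> [m|m mT]; last first.
      by rewrite (out_perm (restr_perm_on _ _)) // -in_setC.
    have [mT|mT] := boolP (m \in T); last by rewrite (out_perm (restr_perm_on _ _)).
    rewrite restr_permE //; move: (hT m) (colorh m).
    by rewrite mT /color; move: mT; rewrite !inE => -> ->.
  - apply/C2P; split=> [m|m mT]; last first.
      by rewrite (out_perm (restr_perm_on _ _)) // in_setC mT.
    have [mT|mT] := boolP (m \in T).
      by rewrite (out_perm (restr_perm_on _ _)) // in_setC mT.
    rewrite restr_permE ?in_setC //; move: (hT m) (colorh m).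
    by rewrite (negPf mT) /color; move: mT; rewrite !inE => /negPf-> -> /addnI.
  apply/permP => m; rewrite permM.
  have [mT|mT] := boolP (m \in T).
    by rewrite (restr_permE hN) // (out_perm (restr_perm_on _ _)) // in_setC hT mT.
  by rewrite (out_perm (restr_perm_on _ _) mT) restr_permE // in_setC.
have [psi [psi_char psiB psi_le]] := @young_module_char _ [group of [set: 'S_n]]
  (row_stab_group n la) (col_stab_group n la) R1 C2 (@odd_perm _) (@odd_permM _)
  (subsetT _) (subsetT _) (subsetIl _ _) (subsetIl _ _) cRC.
exists psi; split=> // g.
apply: le_trans (psi_le g (in_setT g)) _.
have c0 : 0 < (#|R1| * #|C2|)%:R :> algC by rewrite ltr0n muln_gt0 !cardG_gt0.
rewrite ler_pdivrMl // -natrM mulnC.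
apply: le_trans (_ : (\sum_(p in R1) \sum_(q in C2) \sum_(u : 'S_n) (q * p * u * g == u)%g)%N%:R <= _).
  rewrite natr_sum; apply: ler_sum => p _; rewrite natr_sum; apply: ler_sum => q _.
  rewrite natr_sum big_mkcond; apply: ler_sum => u _.
  by rewrite inE.
by rewrite ler_nat (sum_young_le_fix _ tiRC cRC stabE).
Qed.

(** * Bounding the Kronecker coefficient *)

(** As a multiplicity of the trivial character, the coefficient can only grow when a character is
    added to the product. *)
Lemma kronecker_cfdot (n : nat) (la mu nu : seq nat) :
  kronecker n la mu nu
    = '[specht_char n la * specht_char n mu * specht_char n nu, 1].
Proof.
rewrite cfdotE cardsT card_Sn /kronecker; congr (_ * _).
rewrite [RHS]big_mkcond; apply: eq_bigr => s _.
by rewrite inE !cfunE cfun1E inE rmorph1 mulr1.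
Qed.

(** The factors are replaced one at a time, and each change is a product of characters. *)
Lemma char_sub_mul3 (gT : finGroupType) (G : {group gT})
    (a b c a' b' c' : 'CF(G)) :
  a \is a character -> b \is a character ->
  b' \is a character -> c' \is a character ->
  a' - a \is a character -> b' - b \is a character -> c' - c \is a character ->
  a' * b' * c' - a * b * c \is a character.
Proof.
move=> Na Nb Nb' Nc' Da Db Dc.
have -> : a' * b' * c' - a * b * c
    = (a' - a) * b' * c' + a * (b' - b) * c' + a * b * (c' - c) by ring.
by rewrite !rpredD ?rpredM.
Qed.

Theorem corollary5p2 (n : nat) (la mu nu : seq nat) (k : nat) :
  (4 <= n)%N ->
  is_partition n la -> is_partition n mu -> is_partition n nu ->
  k = maxn (diag_len la) (maxn (diag_len mu) (diag_len nu)) ->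
  kronecker n la mu nu <= (n ^ (8 * k ^ 3))%:R.
Proof.
move=> n4 lan mun nun kE.
have n0 : (0 < n)%N by apply: leq_trans n4.
have dla : (diag_len la <= k)%N by rewrite kE leq_maxl.
have dmu : (diag_len mu <= k)%N by rewrite kE !leq_max leqnn orbT.
have dnu : (diag_len nu <= k)%N by rewrite kE !leq_max leqnn !orbT.
(* With [k = 0], the box 0, which exists as [n] is positive, would have a column offset below 0. *)
have k0 : (0 < k)%N.
  case: posnP dla => // -> dla.
  by have := reshape_offset_lt (m := Ordinal n0) lan dla (leq0n _).
have [a [Na Da aF]] := specht_char_coloring lan dla.
have [b [Nb Db bF]] := specht_char_coloring mun dmu.
have [c [Nc Dc cF]] := specht_char_coloring nun dnu.
have Dabc : a * b * c - specht_char n la * specht_char n mu * specht_char n nu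
    \is a character by rewrite char_sub_mul3 ?cfRepr_char.
rewrite kronecker_cfdot.
apply: (@le_trans _ _ '[a * b * c, 1]).
  rewrite -subr_ge0 -cfdotBl natr_ge0 // Cnat_cfdot_char //.
  exact: cfun1_char.
(* The inner product is a natural number, so it equals its norm and can be estimated term by
   term. *)
rewrite -[leLHS]ger0_norm; last first.
  by rewrite natr_ge0 // Cnat_cfdot_char ?rpredM // cfun1_char.
rewrite cfdotE cardsT card_Sn normrM ger0_norm ?invr_ge0 ?ler0n //.
rewrite ler_pdivrMl ?ltr0n ?fact_gt0 //.
apply: le_trans (ler_norm_sum _ _ _) _.
pose X : finType := 'I_(k + k).
apply: (@le_trans _ _ (\sum_(g : 'S_n) #|coloring_fix (X * X * X)%type g|)%N%:R).
  rewrite natr_sum big_mkcond; apply: ler_sum => g _.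
  rewrite inE cfun1E inE rmorph1 mulr1 !cfunE !normrM.
  apply: (@le_trans _ _ (#|coloring_fix X g| ^ 3)%N%:R).
    by rewrite !expnS expn0 muln1 mulnA !natrM !ler_pM ?mulr_ge0 ?normr_ge0.
  by rewrite ler_nat card_coloring_fix3.
(* There are [(2k)^3 = 8 k^3] triples of colors; this positive number is written as a successor to
   fit the orbit count. *)
have cardX : #|{: X * X * X}| = (8 * k ^ 3).-1.+1.
  by rewrite !card_prod card_ord prednK; nia.
rewrite -natrM ler_nat mulnC -[(8 * k ^ 3)%N]prednK; last by rewrite muln_gt0 expn_gt0 k0.
apply: leq_trans (sum_coloring_fix_le _ cardX) _.
rewrite leq_mul2r bin_le_expn ?orbT //.
exact: leq_trans n4.
Qed.
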